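(* The SC-tree corresponds one-to-one to the set $\mathbf{Q}_+$ of positive rational numbers; that is, every positive rational number occurs at exactly one vertex of the SC-tree (the two pseudo-fractions $\frac10$ and $\frac01$ at level 0 being disregarded).
   Context: Let $a,b$ be formal symbols. Consider the infinite binary tree $T$ (the ''S-tree with root $\frac ab$'') whose root is $\frac{a}{b}$ at level 0 and in which every vertex $\frac{u}{v}$ (including the root), where $u,v$ are formal integer linear forms in $a,b$, has left child $\frac{u}{u+v}$ and right child $\frac{v}{u+v}$ in the next level. The two children of a vertex of $T$ have the same denominator, of the form $ma+nb$. The SC-tree is obtained from $T$ by replacing, for each vertex $V$ of $T$, the two children of $V$, whose common denominator is $ma+nb$, by one single vertex $\frac{m}{n}$, placed in the same level as these children; the left (right) child of this SC-vertex is the SC-vertex obtained in the same way from the left (right) child of $V$. Thus level 1 consists of $\frac11$, level 2 of $\frac21,\frac12$ (from left to right), level 3 of $\frac31,\frac32,\frac13,\frac23$, and so on. In addition, two pseudo-fractions $\frac10$ and $\frac01$ are added at level 0, and $\frac11$ is declared to be the right child of $\frac10$ and the left child of $\frac01$. *)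

(* Defs.v *)
From HB Require Import structures.
From mathcomp Require Import all_boot all_order all_algebra.
Set Implicit Arguments.
Unset Strict Implicit.
Unset Printing Implicit Defensive.
Import Order.TTheory GRing.Theory Num.Theory.
Local Open Scope ring_scope.

(* The pair (m, n) stands for the formal linear form m a + n b; the addition
   of linear forms is the componentwise one that int * int already carries. *)
Definition linform : Type := (int * int)%type.
Definition form_a : linform := (1, 0).
Definition form_b : linform := (0, 1).

(* A formal fraction u / v is the pair (u, v); it is never simplified. *)
Definition fraction : Type := (linform * linform)%type.

Definition left_child (x : fraction) : fraction := (x.1, x.1 + x.2).
Definition right_child (x : fraction) : fraction := (x.2, x.1 + x.2).
Definition child (right : bool) (x : fraction) : fraction :=
  if right then right_child x else left_child x.

(* A vertex of an infinite binary tree is the path that leads to it from the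
   root, first step first, with false for a left and true for a right turn. *)
Definition vertex : Type := seq bool.

Definition S_label (V : vertex) : fraction :=
  foldl (fun x d => child d x) (form_a, form_b) V.

Lemma S_label_child (V : vertex) (d : bool) :
  S_label (rcons V d) = child d (S_label V).
Proof. by rewrite /S_label foldl_rcons. Qed.

Lemma siblings_same_denominator (V : vertex) :
  (S_label (rcons V false)).2 = (S_label (rcons V true)).2.
Proof. by rewrite !S_label_child. Qed.

(* The SC-tree has exactly one vertex for each vertex V of the S-tree, and with
   the same left/right structure, so V also serves as its name; it stands one
   level below V, at level (size V).+1.  Its label (m, n), meaning m / n, is
   read off the common denominator m a + n b of the two children of V.
   The two pseudo-fractions of level 0 are not among these vertices. *)
Definition SC_label (V : vertex) : int * int := (S_label (rcons V false)).2.

Definition SC_value (V : vertex) : rat := (SC_label V).1%:Q / (SC_label V).2%:Q.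

Example SC_level1 : SC_label [::] = (1, 1).
Proof. by []. Qed.

Example SC_level2 :
  [seq SC_label V | V <- [:: [:: false]; [:: true]]] = [:: (2, 1); (1, 2)].
Proof. by []. Qed.

Example SC_level3 :
  [seq SC_label V | V <- [:: [:: false; false]; [:: false; true];
                             [:: true; false]; [:: true; true]]]
  = [:: (3, 1); (3, 2); (1, 3); (2, 3)].
Proof. by []. Qed.

(* Main.v *)
(** A step [d] from the root of the S-tree substitutes the two entries of
    [child d (a / b)] for [a] and [b] in every label below.  On the coefficients
    [(m, n)] this is [(m + n, n)] for a left and [(n, m + n)] for a right step,
    so a first left step turns the value [x] into [x + 1 > 1], a first right
    step turns it into [1 / (x + 1) < 1], and the root has the value [1].
    The value thus determines the path step by step, and the subtractive
    Euclidean algorithm produces a path for every positive fraction. *)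
Require Import Defs.
From HB Require Import structures.
From mathcomp Require Import all_boot all_order all_algebra.
From mathcomp Require Import zify ring.
Import Order.TTheory GRing.Theory Num.Theory.
Local Open Scope ring_scope.

(** Children are formed by addition alone, so an additive map applied at the root passes down the
    whole path. *)
Lemma foldl_child_morph (f : linform -> linform) (x : fraction) (V : vertex) :
  {morph f : u v / u + v} ->
  foldl (fun x d => child d x) (f x.1, f x.2) V =
  (f (foldl (fun x d => child d x) x V).1,
   f (foldl (fun x d => child d x) x V).2).
Proof.
move=> fD; elim: V x => [//|d V IHV] x /=; rewrite -IHV.
by case: d; rewrite /child /= fD.
Qed.

Definition subst_step (d : bool) (w : linform) : linform :=
  if d then (w.2, w.1 + w.2) else (w.1 + w.2, w.2).

Lemma subst_stepD (d : bool) : {morph subst_step d : u v / u + v}.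
Proof. by case: d => -[m n] [m' n']; congr pair => /=; ring. Qed.

Lemma SC_labelE (V : vertex) : SC_label V = (S_label V).1 + (S_label V).2.
Proof. by rewrite /SC_label S_label_child. Qed.

Lemma SC_label_cons (d : bool) (V : vertex) :
  SC_label (d :: V) = subst_step d (SC_label V).
Proof.
rewrite !SC_labelE subst_stepD /S_label /=.
(* The first step is thus itself a substitution applied to the root fraction. *)
have -> : child d (form_a, form_b) =
          (subst_step d form_a, subst_step d form_b) by case: d.
by rewrite (@foldl_child_morph _ (form_a, form_b) _ (@subst_stepD d)).
Qed.

Lemma SC_label_gt0 (V : vertex) : 0 < (SC_label V).1 /\ 0 < (SC_label V).2.
Proof.
elim: V => [//|d V [m_gt0 n_gt0]]; rewrite SC_label_cons.
by case: d; rewrite /= ?addr_gt0.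
Qed.

Lemma SC_value_gt0 (V : vertex) : 0 < SC_value V.
Proof. by have [m_gt0 n_gt0] := SC_label_gt0 V; rewrite divr_gt0 ?ltr0z. Qed.

Lemma SC_value_nil : SC_value [::] = 1.
Proof. by []. Qed.

Lemma SC_value_left (V : vertex) : SC_value (false :: V) = SC_value V + 1.
Proof.
have [_ n_gt0] := SC_label_gt0 V.
rewrite /SC_value SC_label_cons /= intrD mulrDl divff //.
by rewrite intr_eq0 gt_eqF.
Qed.

Lemma SC_value_right (V : vertex) : SC_value (true :: V) = (SC_value V + 1)^-1.
Proof.
(* The label after a right step is the one after a left step with its entries swapped. *)
by rewrite -SC_value_left /SC_value !SC_label_cons /= invf_div.
Qed.

Lemma SC_value_left_gt1 (V : vertex) : 1 < SC_value (false :: V).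
Proof. by rewrite SC_value_left ltrDr SC_value_gt0. Qed.

Lemma SC_value_right_lt1 (V : vertex) : SC_value (true :: V) < 1.
Proof.
by rewrite SC_value_right -SC_value_left invf_lt1 ?SC_value_gt0 ?SC_value_left_gt1.
Qed.

Lemma SC_value_inj : injective SC_value.
Proof.
elim=> [|d V IHV] [|d' V'] //.
- by case: d' => e; [have := SC_value_right_lt1 V' | have := SC_value_left_gt1 V'];
    rewrite -e SC_value_nil ltxx.
- by case: d => e; [have := SC_value_right_lt1 V | have := SC_value_left_gt1 V];
    rewrite e SC_value_nil ltxx.
case: d d' => -[] e.
- by move: e; rewrite !SC_value_right => /invr_inj/addIr/IHV ->.
- by have := lt_trans (SC_value_right_lt1 V) (SC_value_left_gt1 V'); rewrite e ltxx.
- by have := lt_trans (SC_value_right_lt1 V') (SC_value_left_gt1 V); rewrite e ltxx.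
- by move: e; rewrite !SC_value_left => /addIr/IHV ->.
Qed.

(** Strong induction on [m + n]; coprimality is not assumed, and the descent stops at the root once
    both entries agree. *)
Lemma SC_value_surj_nat (m n : nat) :
  (0 < m)%N -> (0 < n)%N -> exists V : vertex, SC_value V = m%:R / n%:R.
Proof.
have [k] := ubnP (m + n)%N; elim: k m n => // k IHk m n le_k m_gt0 n_gt0.
have [m_neq0 n_neq0] : m%:R != 0 :> rat /\ n%:R != 0 :> rat.
  by rewrite !pnatr_eq0 -!lt0n.
case: (ltngtP m n) => [lt_mn|lt_nm|<-].
(* Here [m / n] is the inverse of [(n - m) / m + 1], hence a right step. *)
- have [||| V eV] := IHk (n - m)%N m; try lia.
  exists (true :: V); rewrite SC_value_right eV natrB ?(ltnW lt_mn) //.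
  by rewrite mulrBl divff // subrK invf_div.
(* Here [m / n = (m - n) / n + 1], hence a left step. *)
- have [||| V eV] := IHk (m - n)%N n; try lia.
  exists (false :: V); rewrite SC_value_left eV natrB ?(ltnW lt_nm) //.
  by rewrite mulrBl divff // subrK.
- by exists [::]; rewrite SC_value_nil divff.
Qed.

Lemma SC_value_surj (q : rat) : 0 < q -> exists V : vertex, SC_value V = q.
Proof.
move=> q_gt0; have num_gt0 : 0 < numq q by rewrite numq_gt0.
have [||V eV] := @SC_value_surj_nat `|numq q|%N `|denq q|%N.
- by rewrite absz_gt0 gt_eqF.
- by rewrite absz_gt0 denq_neq0.
exists V; rewrite eV -[RHS]divq_num_den.
by rewrite !natr_absz !gtr0_norm ?denq_gt0.
Qed.

Theorem theorem13 :
  (forall V : vertex, (SC_label V).2 != 0 /\ 0 < SC_value V) /\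
  (forall q : rat, 0 < q -> exists! V : vertex, SC_value V = q).
Proof.
split=> [V | q /SC_value_surj [V eV]].
  by have [_ n_gt0] := SC_label_gt0 V; rewrite gt_eqF ?SC_value_gt0.
by exists V; split=> // V' eV'; apply: SC_value_inj; rewrite eV eV'.
Qed.
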